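(* Let $d\ge1$ and $r\in[2,\infty)$. Let $(\mathbf X_t)_{t\ge0}$ be a stationary integer-grid random walk Metropolis--Hastings (IRWMH) chain on $\mathbb Z^d$ with target probability mass function $\pi$ and proposal step probability mass function $\phi$. If $\mathbf X_0\in L^r$, then for any $\mathbf m\in\mathbb R^d$, $$\mathbb E\|\mathbf X_1-\mathbf X_0\|^r\le2^{r-1}\,\mathbb E\|\mathbf X_0-\mathbf m\|^r.$$
   Context: IRWMH chain: $\pi$ and $\phi$ are probability mass functions on $\mathbb Z^d$, with no further conditions. Set $q(\mathbf x,\mathbf y)=\phi(\mathbf y-\mathbf x)$ and $$\alpha(\mathbf x,\mathbf y)=\begin{cases}\min\{1,\ \pi(\mathbf y)q(\mathbf y,\mathbf x)/(\pi(\mathbf x)q(\mathbf x,\mathbf y))\},&\pi(\mathbf x)q(\mathbf x,\mathbf y)>0,\\ 1,&\pi(\mathbf x)q(\mathbf x,\mathbf y)=0.\end{cases}$$ From state $\mathbf x\in\mathbb Z^d$, the Markov chain proposes $\mathbf y$ with probability $q(\mathbf x,\mathbf y)$, moves to $\mathbf y$ with probability $\alpha(\mathbf x,\mathbf y)$, and otherwise stays at $\mathbf x$; so its off-diagonal transition probabilities are $q(\mathbf x,\mathbf y)\alpha(\mathbf x,\mathbf y)$. The chain is stationary: $\mathbf X_0$ (hence every $\mathbf X_t$) has probability mass function $\pi$. $\|\cdot\|$ is the Euclidean norm, and $\mathbf X_0\in L^r$ means $\mathbb E\|\mathbf X_0\|^r<\infty$. *)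

(* Defs.v *)
From HB Require Import structures.
From mathcomp Require Import all_boot all_order all_algebra.
From mathcomp Require Import all_classical all_reals all_analysis.

Set Implicit Arguments.
Unset Strict Implicit.
Unset Printing Implicit Defensive.

Import Order.TTheory GRing.Theory Num.Theory.
Import numFieldNormedType.Exports.

Local Open Scope classical_set_scope.
Local Open Scope ring_scope.

(* An alias of 'rV[int]_d, so that the discrete sigma-algebra can be attached
   to it without giving every matrix type a measurable structure. *)
Definition Zgrid (d : nat) := 'rV[int]_d.

HB.instance Definition _ d := GRing.Zmodule.on (Zgrid d).
HB.instance Definition _ d := Countable.on (Zgrid d).
HB.instance Definition _ d := isPointed.Build (Zgrid d) 0.
HB.instance Definition _ d := @isMeasurable.Build default_measure_display
  (Zgrid d) discrete_measurable discrete_measurable0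
  discrete_measurableC discrete_measurableU.

Definition Zgrid_to_R (R : realType) (d : nat) (x : Zgrid d) : 'rV[R]_d :=
  map_mx intr x.

(* The library's norm on 'rV[R]_d is the sup norm. *)
Definition enorm (R : realType) (d : nat) (v : 'rV[R]_d) : R :=
  Num.sqrt (\sum_(i < d) v ord0 i ^+ 2).

Definition is_pmf (R : realType) (d : nat) (f : Zgrid d -> R) : Prop :=
  (forall x, 0 <= f x) /\ \esum_(x in [set: Zgrid d]) (f x)%:E = 1%E.

Definition proposal (R : realType) (d : nat) (phi : Zgrid d -> R)
    (x y : Zgrid d) : R := phi (y - x).

Definition acceptance (R : realType) (d : nat) (pi phi : Zgrid d -> R)
    (x y : Zgrid d) : R :=
  let q := proposal phi in
  if 0 < pi x * q x y then Num.min 1 (pi y * q y x / (pi x * q x y)) else 1.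

(* The second summand is the total probability of a rejected proposal, which is
   added to the mass at y = x. *)
Definition irwmh_transition (R : realType) (d : nat) (pi phi : Zgrid d -> R)
    (x y : Zgrid d) : R :=
  proposal phi x y * acceptance pi phi x y +
  (if y == x then
     fine (\esum_(z in [set: Zgrid d])
             (proposal phi x z * (1 - acceptance pi phi x z))%:E)
   else 0).

(* The Markov property with transition probabilities K, with the conditional
   probabilities cleared of their denominators. *)
Definition is_markov_chain (R : realType) (dO : measure_display)
    (Omega : measurableType dO) (P : probability Omega R) (d : nat)
    (K : Zgrid d -> Zgrid d -> R) (X : nat -> {RV P >-> Zgrid d}) : Prop :=
  forall (t : nat) (x : nat -> Zgrid d),
    P [set w | forall s : nat, (s <= t.+1)%N -> X s w = x s] =
    (P [set w | forall s : nat, (s <= t)%N -> X s w = x s] *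
     (K (x t) (x t.+1))%:E)%E.

(* Stationarity is stated as X 0 having law pi: pi is invariant for the
   transition probabilities, so every X t then has law pi. *)
Definition is_stationary_irwmh (R : realType) (dO : measure_display)
    (Omega : measurableType dO) (P : probability Omega R) (d : nat)
    (pi phi : Zgrid d -> R) (X : nat -> {RV P >-> Zgrid d}) : Prop :=
  is_markov_chain (irwmh_transition pi phi) X /\
  (forall x : Zgrid d, P (X 0%N @^-1` [set x]) = (pi x)%:E).

(* Main.v *)
Require Import Defs.
From HB Require Import structures.
From mathcomp Require Import all_boot all_order all_algebra.
From mathcomp Require Import all_classical all_reals all_analysis.
From mathcomp Require Import ring lra.

Set Implicit Arguments.
Unset Strict Implicit.
Unset Printing Implicit Defensive.

Import Order.TTheory GRing.Theory Num.Theory.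
Import numFieldNormedType.Exports.

Local Open Scope classical_set_scope.
Local Open Scope ring_scope.

(** Off the diagonal, the stationary chain jumps from x to x + u with
    probability
      flow x u = min (pi x * phi u, pi (x + u) * phi (- u)),
    which is symmetric in the two endpoints of the jump.  Applying
    |X1 - X0|^r <= 2^(r-1) (|X0 - m|^r + |X1 - m|^r) directly gives only the
    constant 2^r; the missing factor 2 comes from looking at a fixed step u and
    at a whole line x + Zu.

    Let s x be the coordinate of x - m along u, in units of u, so that
    s (x + u) = s x + 1 and |s x| |u| <= |x - m| ([proj_coord_le]).  Each edge
    {x, x + u} of the line is charged to those of its endpoints that point away
    from m: to x if s x < 0, and to x + u if 0 < s (x + u).  A vertex is thus
    charged by at most one of its two edges, which is the gain of a factor 2.
    The charge pays for the edge ([edge_bound]): an edge without the origin of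
    the coordinate in its interior has an endpoint with |s| >= 1, which suffices
    alone because r >= 2; an edge across the origin is paid by both endpoints
    together, by the arithmetic-geometric mean inequality and the convexity of
    the power r / 2, where r >= 2 is used again ([two_point_bound]).

    Summing over a line, hence over all x ([flow_line_le]), bounds the
    contribution of u by 2^(r-2) (phi u + phi (- u)) E |X0 - m|^r, and the sum
    over u of phi u + phi (- u) is 2 ([esum_flow_le]). *)

(** * Sums and expectations over countable types *)

Lemma le_esumZl (R : realType) (T : choiceType) (S : set T) (c : R)
    (a : T -> \bar R) : 0 <= c -> (forall i, (0 <= a i)%E) ->
  (\esum_(i in S) (c%:E * a i) <= c%:E * \esum_(i in S) a i)%E.
Proof.
move=> c0 a0; apply: ge_ereal_sup => _ [A [finA AS] <-].
rewrite -ge0_mule_fsumr// lee_wpmul2l ?lee_fin//.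
by apply: ereal_sup_ubound; exists A.
Qed.

Lemma esum_translate (R : realType) (V : zmodType) (a : V -> \bar R) (u : V) :
  \esum_(x in [set: V]) a (x + u) = \esum_(x in [set: V]) a x.
Proof.
rewrite [RHS](reindex_esum setT _ (fun x => x + u))//; split => //.
  by move=> x y _ _ /addIr.
by move=> y _; exists (y - u); rewrite ?subrK.
Qed.

Section discrete_expectation.
Context (R : realType) (d : measure_display) (Omega : measurableType d).
Context (P : probability Omega R) (T : countType).

Lemma measurable_preimage_countable (Y : Omega -> T) (D : set T) :
  (forall t, measurable (Y @^-1` [set t])) -> measurable (Y @^-1` D).
Proof.
move=> mY; have -> : Y @^-1` D = \bigcup_(t in D) Y @^-1` [set t].
  by apply/seteqP; split=> w /= => [Dw|[t Dt ->//]]; exists (Y w).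
rewrite bigcup_mkcond; apply: countable_bigcupT_measurable => [|t].
  exact: countableP.
by case: ifP.
Qed.

(** The fibers of Y partition the sample space, and g (Y w) is constant on each
    of them. *)
Lemma expectation_countable (Y : Omega -> T) (g : T -> R) :
    (forall t, measurable (Y @^-1` [set t])) -> (forall t, 0 <= g t) ->
  ('E_P[(fun w => g (Y w))] =
   \esum_(t in [set: T]) ((g t)%:E * P (Y @^-1` [set t])))%E.
Proof.
move=> mY g0; rewrite unlock.
pose F n := Y @^-1` (pickle @^-1` [set n]).
have mF n : measurable (F n) by exact: measurable_preimage_countable.
have FT : \bigcup_n F n = setT.
  by apply/seteqP; split=> // w _; exists (pickle (Y w)).
(* Countable additivity is available along nat, so the fibers are indexed by the
   codes of the values of Y; the codes of no value contribute 0. *)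
rewrite -FT ge0_integral_bigcup//; last 3 first.
- rewrite FT => _ B _; rewrite setTI.
  exact: (@measurable_preimage_countable Y ((EFin \o g) @^-1` B)).
- by move=> w _; rewrite lee_fin.
- by move=> i j _ _ [w [/= <- <-]].
rewrite nneseries_esumT; last first.
  by move=> n; apply: integral_ge0 => w _; rewrite lee_fin.
rewrite (@esumID _ _ (range (@pickle T))); last first.
  by move=> n _; apply: integral_ge0 => w _; rewrite lee_fin.
rewrite [X in (_ + X)%E]esum1 ?adde0; last first.
  move=> n [_ /= nT]; rewrite (_ : F n = set0) ?integral_set0//.
  by apply/seteqP; split=> // w /= Yw; apply: nT; exists (Y w).
rewrite setTI esum_image; last by move=> t t' _ _ /(pcan_inj pickleK).
apply: eq_esum => t _.
have -> : F (pickle t) = Y @^-1` [set t].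
  by apply/seteqP; split=> [w /(pcan_inj pickleK)|w /= Yw]; rewrite /F/= ?Yw.
rewrite (eq_integral (fun=> (g t)%:E)); last by move=> w /[!inE] /= ->.
by rewrite integral_cst.
Qed.

End discrete_expectation.

(** * The charge inequality on one edge *)

Section scalar.
Variable R : realType.
Implicit Types a b p q r s : R.

(** Convexity of the power r at the midpoint of s and 1 - s. *)
Lemma powR_half_sum_ge r s : 1 <= r -> 0 <= s <= 1 ->
  2 `^ (1 - r) <= s `^ r + (1 - s) `^ r.
Proof.
move=> r1 /andP[s0 s1].
have r0 : 0 <= r by rewrite (le_trans _ r1).
have h0 : (0 : R) <= 2^-1 by rewrite invr_ge0.
have h1 : (2^-1 : R) <= 1 by rewrite invf_le1 ?ler1n.
have half : (2^-1 * s + 2^-1 * (1 - s)) `^ r <=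
    2^-1 * s `^ r + 2^-1 * (1 - s) `^ r.
  rewrite {2 4}(_ : 2^-1 = 1 - 2^-1); last by field.
  by apply: (convex_powR r1 (Itv01 h0 h1)) => //=;
    rewrite inE/= in_itv/= andbT// subr_ge0.
rewrite -!mulrDr subrKC mulr1 in half.
rewrite powRD ?pnatr_eq0 ?implybT// powRr1// powRN.
have -> : (2 `^ r)^-1 = 2^-1 `^ r :> R by rewrite -!powR_inv1 ?powR_ge0// powRAC.
by rewrite -ler_pdivlMl.
Qed.

(** The case of an edge whose endpoints lie on both sides of the origin, at
    distances s and 1 - s from it; equality holds for p = q, a = b and
    s = 1 / 2.  Writing e for the minimum and A, B for the powers r / 2 of the
    distances, the right-hand side is at least 2 `^ (r - 2) * e * (A + B) ^+ 2:
    the square terms because e <= a * p and e <= b * q, and the double product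
    by the arithmetic-geometric mean inequality; then A + B is bounded below by
    convexity. *)
Lemma two_point_bound a b p q r s : 2 <= r -> 0 <= a -> 0 <= b -> 0 <= p ->
    0 <= q -> 0 <= s <= 1 ->
  Num.min (a * p) (b * q) <=
  2 `^ (r - 2) * (p + q) * (a * s `^ r + b * (1 - s) `^ r).
Proof.
move=> r2 a0 b0 p0 q0 s01; set e := Num.min _ _.
have e0 : 0 <= e by rewrite le_min !mulr_ge0.
have ep : e <= a * p by rewrite ge_min lexx.
have eq : e <= b * q by rewrite ge_min lexx orbT.
have sq (x : R) : x `^ r = (x `^ (r / 2)) ^+ 2.
  by rewrite -powR_mulrn ?powR_ge0// -powRrM divfK.
rewrite !sq; set A := s `^ _; set B := (1 - s) `^ _.
have A0 : 0 <= A by exact: powR_ge0.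
have B0 : 0 <= B by exact: powR_ge0.
have AB : 1 <= 2 `^ (r - 2) * (A + B) ^+ 2.
  have -> : 2 `^ (r - 2) = (2 `^ (1 - r / 2))^-1 ^+ 2.
    rewrite -powRN -powR_mulrn ?powR_ge0// -powRrM; congr (_ `^ _).
    by field.
  rewrite -exprMn -[leLHS](expr1n _ 2) ler_sqr ?nnegrE; last 2 first.
  - by [].
  - by rewrite mulr_ge0 ?invr_ge0 ?powR_ge0 ?addr_ge0.
  rewrite ler_pdivlMl ?powR_gt0// mulr1.
  by apply: powR_half_sum_ge => //; lra.
(* AM-GM is proved on squares, which avoids the square root of a * p * b * q. *)
have cross : 2 * e * (A * B) <= a * q * A ^+ 2 + b * p * B ^+ 2.
  rewrite -ler_sqr ?nnegrE; last 2 first.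
  - by rewrite !mulr_ge0.
  - by rewrite addr_ge0 ?mulr_ge0 ?exprn_ge0.
  apply: (@le_trans _ _ (4 * ((a * p) * (b * q)) * (A * B) ^+ 2)).
    have -> : (2 * e * (A * B)) ^+ 2 = 4 * (e * e) * (A * B) ^+ 2 by ring.
    by rewrite ler_wpM2r ?sqr_ge0// ler_wpM2l// ler_pM.
  rewrite -subr_ge0.
  have -> : (a * q * A ^+ 2 + b * p * B ^+ 2) ^+ 2 -
     4 * (a * p * (b * q)) * (A * B) ^+ 2 =
     (a * q * A ^+ 2 - b * p * B ^+ 2) ^+ 2 by ring.
  exact: sqr_ge0.
have main : e * (A + B) ^+ 2 <= (p + q) * (a * A ^+ 2 + b * B ^+ 2).
  have h1 : e * A ^+ 2 <= a * p * A ^+ 2 by rewrite ler_wpM2r ?sqr_ge0.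
  have h2 : e * B ^+ 2 <= b * q * B ^+ 2 by rewrite ler_wpM2r ?sqr_ge0.
  have -> : e * (A + B) ^+ 2 = e * A ^+ 2 + e * B ^+ 2 + 2 * e * (A * B) by ring.
  have -> : (p + q) * (a * A ^+ 2 + b * B ^+ 2) = a * p * A ^+ 2 + b * q * B ^+ 2
     + (a * q * A ^+ 2 + b * p * B ^+ 2) by ring.
  by rewrite !lerD.
rewrite -mulrA; apply: le_trans (ler_wpM2l (powR_ge0 _ _) main).
by rewrite mulrCA ler_peMr.
Qed.

(** Here a and b are the masses of x and x + u, and s and s + 1 are the
    coordinates of these points along u: the edge is charged to the endpoints
    that lie on the outer side, seen from the origin. *)
Lemma edge_bound a b p q r s : 2 <= r -> 0 <= a -> 0 <= b -> 0 <= p ->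
    0 <= q ->
  Num.min (a * p) (b * q) <= 2 `^ (r - 2) * (p + q) *
  ((if s < 0 then a * `|s| `^ r else 0) +
   (if 0 < s + 1 then b * `|s + 1| `^ r else 0)).
Proof.
move=> r2 a0 b0 p0 q0.
have k1 : 1 <= 2 `^ (r - 2) by rewrite -[leLHS](powRr0 2) ler_powR ?ler1n// subr_ge0.
have pow1 (x : R) : 1 <= x -> 1 <= x `^ r.
  by move=> x1; rewrite -[leLHS](powRr0 x) ler_powR//; lra.
(* An endpoint at distance at least 1 pays for the edge alone. *)
have far (c z x : R) : 0 <= c -> 0 <= z <= p + q -> 1 <= x ->
    c * z <= 2 `^ (r - 2) * (p + q) * (c * x `^ r).
  move=> c0 /andP[z0 zpq] /pow1 x1.
  have -> : 2 `^ (r - 2) * (p + q) * (c * x `^ r) =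
    (c * (p + q)) * (2 `^ (r - 2) * x `^ r) by ring.
  apply: (@le_trans _ _ (c * (p + q))); first by rewrite ler_wpM2l.
  by rewrite ler_peMr ?mulr_ge0 ?addr_ge0// mulr_ege1.
case: ltP => s0; case: ltP => s1.
- rewrite (ltr0_norm s0) (gtr0_norm s1).
  have -> : s + 1 = 1 - (- s) by ring.
  by apply: two_point_bound => //; lra.
- rewrite addr0; apply: le_trans (far a p `|s| a0 _ _); first by rewrite ge_min lexx.
    lra.
  rewrite ltr0_norm//; lra.
- rewrite add0r; apply: le_trans (far b q `|s + 1| b0 _ _); first by rewrite ge_min lexx orbT.
    lra.
  rewrite gtr0_norm//; lra.
- lra.
Qed.

End scalar.

(** * Euclidean geometry along a step *)

Section euclid.
Variables (R : realType) (d : nat).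
Implicit Types u v : 'rV[R]_d.

Definition dot u v : R := \sum_(i < d) u ord0 i * v ord0 i.

Lemma enormE u : enorm u = Num.sqrt (dot u u).
Proof. by []. Qed.

Lemma dot_eq0 u : (dot u u == 0) = (u == 0).
Proof.
rewrite psumr_eq0; last by move=> i _; rewrite -expr2 sqr_ge0.
apply/allP/eqP => [u0|-> i _]; last by rewrite mxE mul0r eqxx.
apply/rowP => i; have := u0 i (mem_index_enum i).
by rewrite mxE mulf_eq0 orbb => /eqP.
Qed.

Lemma dotDl u v w : dot (u + v) w = dot u w + dot v w.
Proof. by rewrite -big_split; apply: eq_bigr => i _; rewrite mxE mulrDl. Qed.

Definition proj_coord u v : R := dot v u / dot u u.

Lemma proj_coordDl u v : u != 0 -> proj_coord u (v + u) = proj_coord u v + 1.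
Proof. by move=> u0; rewrite /proj_coord dotDl mulrDl divff// dot_eq0. Qed.

(** The Cauchy-Schwarz inequality, read as: the orthogonal projection of v on
    the line of u is no longer than v. *)
Lemma proj_coord_le u v : `|proj_coord u v| * enorm u <= enorm v.
Proof.
have [->|u0] := eqVneq u 0.
  by rewrite enormE (eqP (_ : dot 0 0 == 0)) ?dot_eq0// sqrtr0 mulr0 sqrtr_ge0.
set s := proj_coord u v.
rewrite -sqrtr_sqr !enormE -sqrtrM ?sqr_ge0// ler_wsqrtr//.
have sE : dot v u = s * dot u u by rewrite divfK ?dot_eq0.
(* Pythagoras: the difference is the squared norm of v - s u. *)
rewrite -subr_ge0.
have -> : dot v v - s ^+ 2 * dot u u =
    \sum_(i < d) (v ord0 i - s * u ord0 i) ^+ 2.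
  have -> : s ^+ 2 * dot u u = 2 * s * dot v u - s ^+ 2 * dot u u.
    by rewrite sE; ring.
  rewrite /dot !mulr_sumr -!sumrB; apply: eq_bigr => i _; ring.
by apply: sumr_ge0 => i _; exact: sqr_ge0.
Qed.

Lemma enorm_Zgrid0 : enorm (Zgrid_to_R R (0 : Zgrid d)) = 0.
Proof. by rewrite /enorm big1 ?sqrtr0// => i _; rewrite !mxE expr0n. Qed.

End euclid.

(** * Flow of the chain along the lines of direction u *)

Section chain.
Variables (R : realType) (d : nat) (pi phi : Zgrid d -> R).
Hypotheses (hpi : is_pmf pi) (hphi : is_pmf phi).
Implicit Types x y u : Zgrid d.

Definition flow x u : R := Num.min (pi x * phi u) (pi (x + u) * phi (- u)).

(** The acceptance probability is made to turn pi x * phi u into the minimum.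
    If the denominator vanishes then so does the flow from x, even though the
    acceptance is set to 1. *)
Lemma irwmh_flow_le x u : u != 0 ->
  pi x * irwmh_transition pi phi x (x + u) <= flow x u.
Proof.
move=> u0; have [pi0 _] := hpi; have [phi0 _] := hphi.
have eqF : (x + u == x) = false.
  by apply/negbTE; apply: contra_neq u0 => /(canRL (addKr x)); rewrite addNr.
have fwd : x + u - x = u by rewrite addrAC subrr add0r.
have bwd : x - (x + u) = - u by rewrite opprD addrA subrr add0r.
rewrite /irwmh_transition eqF addr0 /acceptance /flow /proposal fwd bwd.
case: ifPn => [p0|]; last first.
  rewrite -leNgt mulr1 => p0; rewrite le_min lexx/=.
  by apply: (le_trans p0); rewrite mulr_ge0.
rewrite mulrA minr_pMr ?mulr_ge0// mulr1 mulrCA divff ?mulr1//.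
by rewrite gt_eqF.
Qed.

(** Summing [edge_bound], every x receives at most one charge: from the edge to
    x + u if s x < 0, from the edge to x - u if s x > 0.  The translation
    invariance of the sum over x brings the two kinds of charge together, so the
    lines x + Zu need not be separated. *)
Lemma flow_line_le (r : R) (m : 'rV[R]_d) u : 2 <= r -> u != 0 ->
  (\esum_(x in [set: Zgrid d])
     (enorm (Zgrid_to_R R u) `^ r * flow x u)%:E <=
   (2 `^ (r - 2) * (phi u + phi (- u)))%:E *
   \esum_(x in [set: Zgrid d])
     (pi x * enorm (Zgrid_to_R R x - m) `^ r)%:E)%E.
Proof.
move=> r2 u0; have [pi0 _] := hpi; have [phi0 _] := hphi.
set c := 2 `^ _ * _.
have c0 : 0 <= c by rewrite mulr_ge0 ?powR_ge0 ?addr_ge0.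
pose w x := pi x * enorm (Zgrid_to_R R x - m) `^ r.
have w0 x : 0 <= w x by rewrite mulr_ge0 ?powR_ge0.
pose s x := proj_coord (Zgrid_to_R R u) (Zgrid_to_R R x - m).
have uR0 : Zgrid_to_R R u != 0.
  apply: contra_neq u0 => /rowP uR; apply/rowP => i; have := uR i.
  by rewrite !mxE => /eqP; rewrite intr_eq0 => /eqP.
have sD x : s (x + u) = s x + 1.
  by rewrite -proj_coordDl// /s /Zgrid_to_R raddfD addrAC.
pose A x := if s x < 0 then w x else 0.
pose B x := if 0 < s x then w x else 0.
have A0 x : 0 <= A x by rewrite /A; case: ifP.
have B0 x : 0 <= B x by rewrite /B; case: ifP.
have AB x : A x + B x <= w x.
  by rewrite /A /B; case: ltgtP => _; rewrite ?addr0 ?add0r.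
have sw x : pi x * `|s x| `^ r * enorm (Zgrid_to_R R u) `^ r <= w x.
  rewrite -mulrA ler_wpM2l// -powRM ?sqrtr_ge0//.
  rewrite ge0_ler_powR ?nnegrE ?mulr_ge0 ?sqrtr_ge0 ?proj_coord_le//; lra.
have edge x : enorm (Zgrid_to_R R u) `^ r * flow x u <= c * (A x + B (x + u)).
  have := @edge_bound R (pi x) (pi (x + u)) (phi u) (phi (- u)) r (s x) r2
    (pi0 _) (pi0 _) (phi0 _) (phi0 _).
  rewrite -/(flow x u) -/c => /(ler_wpM2l (powR_ge0 (enorm (Zgrid_to_R R u)) r)).
  move=> /le_trans; apply; rewrite mulrCA ler_wpM2l// mulrDr lerD//.
    by rewrite /A; case: ifP => _; rewrite ?mulr0// mulrC.
  by rewrite /B sD; case: ifP => _; rewrite ?mulr0// mulrC -sD.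
apply: (@le_trans _ _ (\esum_(x in [set: Zgrid d])
   (c%:E * ((A x)%:E + (B (x + u))%:E)))%E).
  by apply: le_esum => x _; rewrite -EFinD -EFinM lee_fin.
apply: (le_trans (le_esumZl _ c0 _)) => [x|]; first by rewrite adde_ge0// lee_fin.
rewrite lee_wpmul2l ?lee_fin//.
rewrite esumD; do ?by move=> *; rewrite lee_fin.
rewrite (esum_translate (fun x => (B x)%:E)) -esumD; do ?by move=> *; rewrite lee_fin.
by apply: le_esum => x _; rewrite -EFinD lee_fin.
Qed.

(** The factor 2 between the two exponents r - 2 and r - 1 is the sum over u of
    phi u + phi (- u). *)
Lemma esum_flow_le (r : R) (m : 'rV[R]_d) : 2 <= r ->
  (\esum_(u in [set: Zgrid d]) \esum_(x in [set: Zgrid d])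
     (enorm (Zgrid_to_R R u) `^ r * flow x u)%:E <=
   (2 `^ (r - 1))%:E * \esum_(x in [set: Zgrid d])
     (pi x * enorm (Zgrid_to_R R x - m) `^ r)%:E)%E.
Proof.
move=> r2; have [pi0 _] := hpi; have [phi0 phi1] := hphi.
set M := (X in (_ <= _ * X)%E).
have M0 : (0 <= M)%E.
  by apply: esum_ge0 => x _; rewrite lee_fin mulr_ge0 ?powR_ge0.
have [->|Mfin] := eqVneq M +oo%E.
  by rewrite mulry gtr0_sg ?powR_gt0// mul1e leey.
have ME : M = (fine M)%:E by rewrite fineK// ge0_fin_numE// ltey.
have fM0 : 0 <= fine M by exact: fine_ge0.
have k0 : 0 <= fine M * 2 `^ (r - 2) by rewrite mulr_ge0 ?powR_ge0.
apply: (@le_trans _ _ (\esum_(u in [set: Zgrid d])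
   ((fine M * 2 `^ (r - 2))%:E * ((phi u)%:E + (phi (- u))%:E)))%E).
  apply: le_esum => u _; have [->|u0] := eqVneq u 0.
    rewrite esum1 ?mule_ge0 ?adde_ge0 ?lee_fin// => x _.
    by rewrite enorm_Zgrid0 powR0 ?mul0r//; lra.
  apply: (le_trans (flow_line_le m r2 u0)).
  by rewrite -/M ME -EFinD -!EFinM lee_fin le_eqVlt; apply/orP; left; apply/eqP; ring.
apply: (le_trans (le_esumZl _ k0 _)) => [u|]; first by rewrite adde_ge0// lee_fin.
rewrite esumD; do ?by move=> *; rewrite lee_fin.
have -> : \esum_(u in [set: Zgrid d]) (phi (- u))%:E = 1%E.
  by rewrite -phi1 [RHS](reindex_esum setT _ (fun u => - u))//; split => //.
rewrite phi1 ME -EFinD -!EFinM lee_fin le_eqVlt; apply/orP; left; apply/eqP.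
have -> : 2 `^ (r - 1) = 2 * 2 `^ (r - 2) :> R.
  by rewrite (_ : r - 2 = r - 1 - 1) ?mulr_powRB1//; [lra|ring].
ring.
Qed.

End chain.

(** * Joint law of the first step *)

Section joint_law.
Context (R : realType) (dO : measure_display) (Omega : measurableType dO).
Context (P : probability Omega R) (d : nat) (pi phi : Zgrid d -> R).
Variable X : nat -> {RV P >-> Zgrid d}.

Lemma measurable_fiber t (x : Zgrid d) : measurable (X t @^-1` [set x]).
Proof. by rewrite -[X in measurable X]setTI; exact: measurable_funP. Qed.

(** The step comes first, so that the expectation over this pair is directly a
    sum over u of sums over x. *)
Definition step_start (w : Omega) : Zgrid d * Zgrid d :=
  (X 1%N w - X 0%N w, X 0%N w).

Lemma step_startE u x : step_start @^-1` [set (u, x)] =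
  X 0%N @^-1` [set x] `&` X 1%N @^-1` [set x + u].
Proof.
apply/seteqP; split=> w /=.
  by move=> [<- <-]; rewrite addrC subrK.
by case=> X0 X1; rewrite /step_start X0 X1 addrAC subrr add0r.
Qed.

Lemma step_start_law u x : is_stationary_irwmh pi phi X ->
  P (step_start @^-1` [set (u, x)]) =
  (pi x * irwmh_transition pi phi x (x + u))%:E.
Proof.
move=> [markov law0]; rewrite step_startE EFinM -law0.
have := markov 0%N (fun s => if s is 0%N then x else x + u).
have -> : [set w | forall s : nat, (s <= 0)%N ->
    X s w = if s is 0%N then x else x + u] = X 0%N @^-1` [set x].
  by apply/seteqP; split=> w /= => [/(_ 0%N)->//|X0 [|s]//].
have -> // : [set w | forall s : nat, (s <= 1)%N ->
    X s w = if s is 0%N then x else x + u] =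
    X 0%N @^-1` [set x] `&` X 1%N @^-1` [set x + u].
apply/seteqP; split=> w /=.
  by move=> h; split; [exact: (h 0%N)|exact: (h 1%N)].
by move=> [X0 X1] [|[|s]].
Qed.

End joint_law.

Theorem theorem5p1 (R : realType) (d : nat) (hd : (1 <= d)%N)
    (r : R) (hr : 2 <= r)
    (pi phi : Zgrid d -> R) (hpi : is_pmf pi) (hphi : is_pmf phi)
    (dO : measure_display) (Omega : measurableType dO)
    (P : probability Omega R) (X : nat -> {RV P >-> Zgrid d})
    (hX : is_stationary_irwmh pi phi X)
    (hLr : ('E_P[(fun w => enorm (Zgrid_to_R R (X 0%N w)) `^ r)%R] < +oo)%E)
    (m : 'rV[R]_d) :
  ('E_P[(fun w => enorm (Zgrid_to_R R (X 1%N w - X 0%N w)) `^ r)%R] <=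
   (2 `^ (r - 1))%R%:E *
   'E_P[(fun w => enorm (Zgrid_to_R R (X 0%N w) - m) `^ r)%R])%E.
Proof.
rewrite (@expectation_countable R dO Omega P _ (X 0%N)
  (fun x => enorm (Zgrid_to_R R x - m) `^ r)); last 2 first.
- exact: measurable_fiber.
- by move=> x; exact: powR_ge0.
rewrite (@expectation_countable R dO Omega P _ (step_start X)
  (fun ux => enorm (Zgrid_to_R R ux.1) `^ r)); last 2 first.
- move=> [u x]; rewrite step_startE.
  by apply: measurableI; exact: measurable_fiber.
- by move=> ux; exact: powR_ge0.
have [_ law0] := hX.
under [X in (_ <= _ * X)%E]eq_esum => x _ do rewrite law0 -EFinM mulrC.
apply: le_trans (esum_flow_le hpi hphi m hr).
rewrite esum_esum; last first.
  move=> u x _ _; rewrite lee_fin mulr_ge0 ?powR_ge0//.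
  by case: hpi => pi0 _; case: hphi => phi0 _; rewrite le_min !mulr_ge0.
rewrite (_ : _ `*`` _ = setT); last by apply/seteqP; split.
apply: le_esum => -[u x] _ /=.
rewrite (step_start_law _ _ hX) -EFinM lee_fin.
(* The mass of the rejected proposals sits at u = 0, where the integrand
   vanishes. *)
have [->|u0] := eqVneq u 0; last first.
  by rewrite ler_wpM2l ?powR_ge0// (irwmh_flow_le hpi hphi).
by rewrite enorm_Zgrid0 powR0 ?mul0r//; lra.
Qed.
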